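(* Let $A$ be the free algebra in one variable $x$ of a variety of symmetric $m$-ary algebras over a field $k$ of characteristic $0$ and let $D=\langle x,x,\ldots,x\rangle\partial_x\in\mathscr{L}(A)$. Then the following statements are true: (i) If $D^2=0$, then $R_D$ is nilpotent; (ii) If $m=2$ and $D^{[3]}=0$, then $R_D$ is nilpotent.
   Context: Let $m\ge 2$. An $m$-ary algebra over $k$ is a $k$-vector space with one $m$-ary multilinear operation $\langle\cdot,\ldots,\cdot\rangle$; it is symmetric if $\langle a_1,\ldots,a_m\rangle=\langle a_{\sigma(1)},\ldots,a_{\sigma(m)}\rangle$ for all elements $a_1,\ldots,a_m$ and all permutations $\sigma\in S_m$. A derivation is a $k$-linear map satisfying the Leibniz rule for the operation. If $m=2$ and the variety is a unitary variety (a variety of algebras with identity element), $A$ is assumed to contain an identity element. Varieties are assumed nontrivial. For $a\in A$, $a\partial_x$ denotes the unique derivation of $A$ with $x\mapsto a$; every derivation of $A$ has this form. $\mathscr{L}(A)$ denotes the space $\mathrm{Der}_kA$ of all $k$-linear derivations of $A$ with the product $(a\partial_x)\cdot(b\partial_x)=((a\partial_x)(b))\partial_x$ for $a,b\in A$. Powers are taken in $\mathscr{L}(A)$: $D^2=D\cdot D$ and $D^{[3]}=(D\cdot D)\cdot D$. $R_D:\mathscr{L}(A)\to\mathscr{L}(A)$ is the right multiplication operator $u\mapsto u\cdot D$. *)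

(* Defs.v *)
From HB Require Import structures.
From mathcomp Require Import all_boot all_order all_algebra all_fingroup.
From mathcomp Require Import boolp classical_sets functions.

Set Implicit Arguments.
Unset Strict Implicit.
Unset Printing Implicit Defensive.

Import GRing.Theory.
Local Open Scope ring_scope.

Definition upd (T : Type) (m : nat) (v : {ffun 'I_m -> T}) (i : 'I_m) (a : T) :
    {ffun 'I_m -> T} :=
  [ffun j => if j == i then a else v j].

(* The Boolean [u] says whether the signature contains an identity element:
   [unity] is a constant when [u] is true and carries no data when [u] is false.
   The value true is only used with m = 2, where [unity_law] says
   <1, a> = a = <a, 1>. *)
Record mary_algebra (k : fieldType) (m : nat) (u : bool) := MaryAlgebra {
  carrier :> lmodType k;
  op : {ffun 'I_m -> carrier} -> carrier;
  op_multilinear : forall (v : {ffun 'I_m -> carrier}) (i : 'I_m) (c : k)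
    (a b : carrier),
    op (upd v i (c *: a + b)) = c *: op (upd v i a) + op (upd v i b);
  unity : u -> carrier;
  unity_law : forall (hu : u) (i : 'I_m) (a : carrier),
    op (upd [ffun=> unity hu] i a) = a
}.

Arguments op {k m u} A v : rename.
Arguments unity {k m u} A hu : rename.

Definition symmetric_op (k : fieldType) (m : nat) (u : bool)
    (A : mary_algebra k m u) : Prop :=
  forall (s : 'S_m) (v : {ffun 'I_m -> A}),
    op A [ffun i => v (s i)] = op A v.

(* Non-associative m-ary polynomials in countably many variables, written as
   formal expressions. *)
Inductive term (k : fieldType) (m : nat) (u : bool) : Type :=
| TVar of nat
| TAdd of term k m u & term k m u
| TScale of k & term k m u
| TOp of ('I_m -> term k m u)
| TOne of u.

Fixpoint eval (k : fieldType) (m : nat) (u : bool) (A : mary_algebra k m u)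
    (rho : nat -> A) (t : term k m u) : A :=
  match t with
  | TVar n => rho n
  | TAdd t1 t2 => eval rho t1 + eval rho t2
  | TScale c t1 => c *: eval rho t1
  | TOp ts => op A [ffun i => eval rho (ts i)]
  | TOne hu => unity A hu
  end.

(* A variety is given by a set of defining identities t = 0. *)
Definition variety (k : fieldType) (m : nat) (u : bool) : Type :=
  term k m u -> Prop.

Definition in_variety (k : fieldType) (m : nat) (u : bool)
    (V : variety k m u) (A : mary_algebra k m u) : Prop :=
  forall t : term k m u, V t -> forall rho : nat -> A, eval rho t = 0.

Definition nontrivial_variety (k : fieldType) (m : nat) (u : bool)
    (V : variety k m u) : Prop :=
  exists A : mary_algebra k m u, in_variety V A /\ exists a : A, a <> 0.

Definition symmetric_variety (k : fieldType) (m : nat) (u : bool)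
    (V : variety k m u) : Prop :=
  forall A : mary_algebra k m u, in_variety V A -> symmetric_op A.

Definition is_hom (k : fieldType) (m : nat) (u : bool)
    (A B : mary_algebra k m u) (f : A -> B) : Prop :=
  [/\ linear f,
      forall v : {ffun 'I_m -> A}, f (op A v) = op B [ffun i => f (v i)]
    & forall hu : u, f (unity A hu) = unity B hu].

Definition is_free_on (k : fieldType) (m : nat) (u : bool)
    (V : variety k m u) (A : mary_algebra k m u) (x : A) : Prop :=
  in_variety V A /\
  forall B : mary_algebra k m u, in_variety V B ->
    forall b : B, exists! f : A -> B, is_hom f /\ f x = b.

Arguments is_free_on {k m u} V A x.

Definition is_derivation (k : fieldType) (m : nat) (u : bool)
    (A : mary_algebra k m u) (d : A -> A) : Prop :=
  linear d /\
  forall v : {ffun 'I_m -> A}, d (op A v) = \sum_i op A (upd v i (d (v i))).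

Definition derivation_pred (k : fieldType) (m : nat) (u : bool)
    (A : mary_algebra k m u) : {pred (A -> A)} :=
  fun d => `[< is_derivation d >].

Lemma upd_id (T : Type) (m : nat) (v : {ffun 'I_m -> T}) (i : 'I_m) :
  upd v i (v i) = v.
Proof. by apply/ffunP => j; rewrite ffunE; case: eqP => [->|]. Qed.

Lemma op_upd0 (k : fieldType) (m : nat) (u : bool) (A : mary_algebra k m u)
    (v : {ffun 'I_m -> A}) (i : 'I_m) : op A (upd v i 0) = 0.
Proof.
have := op_multilinear v i (-1) 0 0.
by rewrite scaler0 addr0 scaleN1r addNr.
Qed.

Lemma derivation_submod_closed (k : fieldType) (m : nat) (u : bool)
    (A : mary_algebra k m u) : submod_closed (@derivation_pred k m u A).
Proof.
split.
  apply/asboolP; split=> [c a b|v]; first by rewrite /= scaler0 addr0.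
  by rewrite big1 // => i _; rewrite op_upd0.
move=> c d e /asboolP[dl dL] /asboolP[el eL]; apply/asboolP; split.
  move=> a p q; rewrite !fctE dl el !scalerDr !scalerA (mulrC a c).
  by rewrite !addrA; congr (_ + _); rewrite -!addrA; congr (_ + _); rewrite addrC.
move=> v; rewrite !fctE dL eL scaler_sumr -big_split /=.
by apply: eq_bigr => i _; rewrite op_multilinear.
Qed.

HB.instance Definition _ (k : fieldType) (m : nat) (u : bool)
    (A : mary_algebra k m u) :=
  GRing.isSubmodClosed.Build k (A -> A) (@derivation_pred k m u A)
    (@derivation_submod_closed k m u A).

Record Der (k : fieldType) (m : nat) (u : bool) (A : mary_algebra k m u) :=
  MkDer { der_fun :> A -> A; _ : der_fun \in @derivation_pred k m u A }.

HB.instance Definition _ (k : fieldType) (m : nat) (u : bool)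
    (A : mary_algebra k m u) := [isSub for @der_fun k m u A].
HB.instance Definition _ (k : fieldType) (m : nat) (u : bool)
    (A : mary_algebra k m u) := [Choice of Der A by <:].
HB.instance Definition _ (k : fieldType) (m : nat) (u : bool)
    (A : mary_algebra k m u) := [SubChoice_isSubLmodule of Der A by <:].

(* a d_x: the derivation sending x to a.  When A is free on x and k is
   infinite there is exactly one; the default value 0 is only there to make
   the function total. *)
Definition partial (k : fieldType) (m : nat) (u : bool)
    (A : mary_algebra k m u) (x a : A) : Der A :=
  xget 0 [set d : Der A | d x = a]%classic.

(* The product of L(A), for A free on x: D = a d_x and E = b d_x with a = D x
   and b = E x, so (a d_x)(b d_x) = (a d_x)(b) d_x is D (E x) d_x. *)
Definition lmul (k : fieldType) (m : nat) (u : bool)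
    (A : mary_algebra k m u) (x : A) (D E : Der A) : Der A :=
  partial x (D (E x)).

Definition right_mul (k : fieldType) (m : nat) (u : bool)
    (A : mary_algebra k m u) (x : A) (D : Der A) : Der A -> Der A :=
  fun E => lmul x E D.

Definition nilpotent_map (V : nmodType) (f : V -> V) : Prop :=
  exists n : nat, forall v : V, iter n f v = 0.

(* Main.v *)
Require Import Defs.
From mathcomp Require Import all_boot all_order all_algebra all_fingroup.
From mathcomp Require Import boolp classical_sets functions.

(* Evaluating derivations at [x] identifies L(A) with A and turns [R_D] into
   m L, where L a = <a, x, ..., x>; so L has to be nilpotent.

   Derivations of A with a prescribed value at [x] correspond to homomorphisms
   from A to the dual numbers A[e] lifting the identity. Identities of A hold in
   A[e] because a polynomial function vanishing on k has zero coefficients.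

   (i) Put y = D x, so that D y = 0. The bracket of D with a derivation sending
   [x] to [a] gives [D, L] = - m L^2, hence ad(D)^m L is a nonzero multiple of
   L^(m+1). On the other hand ad(D) replaces an argument [x] of L by [y] and kills
   [y], and only m - 1 arguments are available, so ad(D)^m L = 0.

   (ii) The hypothesis says ((x x) x) x = 0. Put y = x x, t = y x, z = y y and let
   L, M be the multiplications by [x] and [y]. Linearization shows that t acts as
   - 2 L^3 - L M. With E x = t one has D y = 2 t, D t = z, D z = 4 y t, E y = 0,
   E t = y t and E z = 0, so that ad(D) and ad(E) act on polynomials in L and M,
   and comparing the two expressions for the action of y t and of E z yields
   relations between L and M of degrees 5 and 6. Among their consequences are
   p(l, r) M = - 32 L^7 and q(l, r) M = - 64 L^8, where l and r are the left and
   right multiplications by L, p(1, 1) = 0 and q(1, 1) = - 16. As l and r commute,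
   q(l, r) (p(l, r) M) = p(l, r) (q(l, r) M) reads 512 L^13 = 0. *)

Set Implicit Arguments.
Unset Strict Implicit.
Unset Printing Implicit Defensive.

Import GRing.Theory.
Local Open Scope ring_scope.

Lemma linear_fun0 (k : fieldType) (V W : lmodType k) (f : V -> W) :
  linear f -> f 0 = 0.
Proof.
by move=> flin; have := flin (-1) 0 0; rewrite scaler0 addr0 scaleN1r addNr.
Qed.

(** * Vector-valued polynomial functions over a field of characteristic 0 *)

Section Char0.
Variables (k : fieldType) (hk : [pchar k] =i pred0) (V : lmodType k).

Lemma pchar0_mulrn_eq0 (v : V) (n : nat) : (0 < n)%N -> v *+ n = 0 -> v = 0.
Proof.
move=> n0 /eqP; rewrite -scaler_nat scaler_eq0 => /orP[|/eqP//].
by rewrite ((pcharf0P k).1 hk) => /eqP n00; rewrite n00 in n0.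
Qed.

(** Vanishing is required at nonzero [s] only, because [jet_eq0] first divides by [s]. *)
Lemma power_sum_eq0 (n : nat) (c : nat -> V) :
  (forall s : k, s != 0 -> \sum_(j < n) s ^+ j *: c j = 0) ->
  forall j, (j < n)%N -> c j = 0.
Proof.
elim: n c => [//|n IHn] c hc.
have two0 : (2 : k) != 0 by rewrite ((pcharf0P k).1 hk).
have cj0 j : (j < n)%N -> c j = 0.
  move=> jn.
  (* P(2 s) - 2^n P(s) is a vanishing combination without its term of degree n. *)
  have : (2 ^+ j - 2 ^+ n) *: c j = 0.
    apply: (IHn (fun j => (2 ^+ j - 2 ^+ n) *: c j)) => // s s0.
    have := hc (2 * s); rewrite mulf_neq0// => /(_ isT).
    have := congr1 (fun v => 2 ^+ n *: v) (hc s s0).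
    rewrite scaler0 !big_ord_recr /= scalerDr scalerA -exprMn => e1 e2.
    transitivity (\sum_(i < n) (2 * s) ^+ i *: c i
                  - 2 ^+ n *: \sum_(i < n) s ^+ i *: c i).
      rewrite scaler_sumr -sumrB; apply: eq_bigr => i _.
      rewrite !scalerA exprMn -scalerBl; congr (_ *: _); rewrite mulrBr.
      by congr (_ - _); rewrite mulrC.
    apply/eqP; rewrite subr_eq0; apply/eqP.
    by apply: (addIr ((2 * s) ^+ n *: c n)); rewrite e1 e2.
  move=> /eqP; rewrite scaler_eq0 => /orP[|/eqP//].
  (* Cancelling 2^j leaves 1 = 2^(n - j), which is excluded because the positive integer 2^(n - j) -
     1 is nonzero in [k]. *)
  rewrite subr_eq0 -(subnKC (ltnW jn)) exprD -[X in X == _]mulr1.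
  rewrite (inj_eq (mulfI _)) ?expf_neq0// -natrX eq_sym -subr_eq0.
  rewrite -(natrB k (n := 1)) ?expn_gt0// ((pcharf0P k).1 hk) subn_eq0 leqNgt.
  by rewrite -{1}(expn0 2) ltn_exp2l// subn_gt0 jn.
move=> j; rewrite ltnS leq_eqVlt => /predU1P[->|/cj0//].
have := hc 1 (oner_neq0 _).
rewrite big_ord_recr /= expr1n scale1r big1 ?add0r// => i _.
by rewrite cj0 ?scaler0.
Qed.

(** Horner form: an induction peels off the constant term, and no degree has to be tracked. *)
Inductive polyfun : (k -> V) -> Prop :=
| Polyfun0 p of (forall s, p s = 0) : polyfun p
| PolyfunS p q a of polyfun q & (forall s, p s = a + s *: q s) : polyfun p.

Lemma polyfun_cst (a : V) : polyfun (fun=> a).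
Proof.
apply: (@PolyfunS _ (fun=> 0) a) => [|s]; first exact: Polyfun0.
by rewrite scaler0 addr0.
Qed.

Lemma polyfunX (p : k -> V) : polyfun p -> polyfun (fun s => s *: p s).
Proof. by move=> hp; apply: (@PolyfunS _ p 0) => // s; rewrite add0r. Qed.

Lemma polyfunD (p q : k -> V) :
  polyfun p -> polyfun q -> polyfun (fun s => p s + q s).
Proof.
move=> hp; elim: hp q => {p} [p p0|p p' a hp' IH hp] q hq.
  by rewrite (_ : (fun s => _) = q)//; apply/funext => s; rewrite p0 add0r.
case: hq => {q} [q q0|q q' b hq' hq].
  by apply: (PolyfunS hp') => s; rewrite q0 addr0.
apply: (@PolyfunS _ (fun s => p' s + q' s) (a + b)); first exact: IH.
by move=> s; rewrite hp hq scalerDr addrACA.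
Qed.

Lemma polyfunZ (c : k) (p : k -> V) : polyfun p -> polyfun (fun s => c *: p s).
Proof.
elim=> {p} [p p0|p q a _ IH hp]; first by apply: Polyfun0 => s; rewrite p0 scaler0.
apply: (PolyfunS (a := c *: a) IH) => s.
by rewrite hp scalerDr !scalerA mulrC.
Qed.

Lemma polyfun_sum (p : k -> V) : polyfun p ->
  exists n (c : nat -> V), forall s, p s = \sum_(j < n) s ^+ j *: c j.
Proof.
elim=> {p} [p p0|p q a _ [n [c hc]] hp].
  by exists 0%N, (fun=> 0) => s; rewrite big_ord0.
exists n.+1, (fun j => if j is j'.+1 then c j' else a) => s.
rewrite big_ord_recl expr0 scale1r hp hc scaler_sumr; congr (_ + _).
by apply: eq_bigr => i _; rewrite scalerA exprS.
Qed.

(** The expansion of [p] modulo s^2, with a polynomial remainder: [a] is the value and [b] the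
    derivative at 0. *)
Definition jet (p : k -> V) (a b : V) : Prop :=
  exists2 q, polyfun q & forall s, p s = a + s *: b + s ^+ 2 *: q s.

Lemma jet_polyfun (p : k -> V) (a b : V) : jet p a b -> polyfun p.
Proof.
move=> [q hq hp].
apply: (@PolyfunS _ (fun s => b + s *: q s) a); first exact: (PolyfunS hq).
by move=> s; rewrite hp scalerDr scalerA addrA.
Qed.

Lemma polyfun_jet (p : k -> V) : polyfun p -> exists ab : V * V, jet p ab.1 ab.2.
Proof.
case=> {p} [p p0|p q a hq hp].
  exists (0, 0), (fun=> 0); first exact: Polyfun0.
  by move=> s; rewrite p0 !scaler0 !addr0.
case: hq hp => {q} [q q0|q r b hr hq] hp.
  exists (a, 0), (fun=> 0); first exact: Polyfun0.
  by move=> s; rewrite hp q0 !scaler0 !addr0.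
exists (a, b), r => // s.
by rewrite hp hq scalerDr scalerA addrA.
Qed.

Lemma jet_cst (a : V) : jet (fun=> a) a 0.
Proof.
exists (fun=> 0); first exact: Polyfun0.
by move=> s; rewrite !scaler0 !addr0.
Qed.

Lemma jetD (p p' : k -> V) (a b a' b' : V) :
  jet p a b -> jet p' a' b' -> jet (fun s => p s + p' s) (a + a') (b + b').
Proof.
move=> [q hq hp] [q' hq' hp']; exists (fun s => q s + q' s); first exact: polyfunD.
by move=> s; rewrite hp hp' !scalerDr addrACA; congr (_ + _); rewrite addrACA.
Qed.

Lemma jetZ (c : k) (p : k -> V) (a b : V) :
  jet p a b -> jet (fun s => c *: p s) (c *: a) (c *: b).
Proof.
move=> [q hq hp]; exists (fun s => c *: q s); first exact: polyfunZ.
by move=> s; rewrite hp !scalerDr !scalerA (mulrC c) (mulrC c (s ^+ 2)).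
Qed.

Lemma jetX (p : k -> V) (a b : V) : jet p a b -> jet (fun s => s *: p s) 0 a.
Proof.
move=> [q hq hp]; exists (fun s => b + s *: q s); first exact: (PolyfunS hq).
by move=> s; rewrite hp add0r !scalerDr !scalerA !expr2 mulrA addrA.
Qed.

(** At s = 0 one reads off a = 0. Division by [s] then shows that the polynomial b + s q(s) vanishes
    for s != 0, so all its coefficients are 0, in particular [b]. *)
Lemma jet_eq0 (p : k -> V) (a b : V) :
  jet p a b -> (forall s, p s = 0) -> a = 0 /\ b = 0.
Proof.
move=> [q hq hp] p0.
have a0 : a = 0 by have := hp 0; rewrite p0 expr0n !scale0r !addr0.
split=> //.
have [|n [c hc]] := @polyfun_sum (fun s => b + s *: q s).
  exact: (PolyfunS hq).
have c0 j : (j < n)%N -> c j = 0.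
  apply: power_sum_eq0 => s s0; rewrite -hc; apply: (scalerI s0).
  by rewrite scaler0 scalerDr scalerA -expr2 -[RHS](p0 s) hp a0 add0r.
have := hc 0; rewrite scale0r addr0 => ->.
by rewrite big1 // => i _; rewrite c0 ?scaler0.
Qed.

End Char0.

(** * Multilinear operations with polynomial arguments *)

Section Upd.
Variables (T : Type) (m : nat).
Implicit Types (v : {ffun 'I_m -> T}).

Lemma upd_upd v i a b : upd (upd v i a) i b = upd v i b.
Proof. by apply/ffunP => j; rewrite !ffunE; case: eqP. Qed.

Lemma updC v i j a b : i != j -> upd (upd v i a) j b = upd (upd v j b) i a.
Proof.
move=> ij; apply/ffunP => l; rewrite !ffunE.
by case: eqP => // ->; case: eqP => // /eqP; rewrite eq_sym (negPf ij).
Qed.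

Lemma upd_same v i a : upd v i a i = a.
Proof. by rewrite ffunE eqxx. Qed.

Lemma upd_other v i j a : j != i -> upd v i a j = v j.
Proof. by move=> /negPf ji; rewrite ffunE ji. Qed.

End Upd.

Lemma map_upd (T S : Type) (m : nat) (f : T -> S) (v : {ffun 'I_m -> T}) i a :
  [ffun j => f (upd v i a j)] = upd [ffun j => f (v j)] i (f a).
Proof. by apply/ffunP => j; rewrite !ffunE; case: eqP. Qed.

Section Algebra.
Variables (k : fieldType) (m : nat) (u : bool).
Implicit Type A : mary_algebra k m u.

Lemma op_updD A (v : {ffun 'I_m -> A}) i a b :
  op A (upd v i (a + b)) = op A (upd v i a) + op A (upd v i b).
Proof. by have := op_multilinear v i 1 a b; rewrite !scale1r. Qed.

Lemma op_updZ A (v : {ffun 'I_m -> A}) i c a :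
  op A (upd v i (c *: a)) = c *: op A (upd v i a).
Proof. by have := op_multilinear v i c a 0; rewrite op_upd0 !addr0. Qed.

Section PolynomialOperations.
Variable A : mary_algebra k m u.

(** The positions outside [r] are frozen at [w], which makes induction on the set of varying
    arguments possible. *)
Definition mix (r : seq 'I_m) (q : 'I_m -> A) (w : {ffun 'I_m -> A}) :
    {ffun 'I_m -> A} :=
  [ffun j => if j \in r then q j else w j].

Lemma mix_cons i r q w : mix (i :: r) q w = upd (mix r q w) i (q i).
Proof. by apply/ffunP => j; rewrite !ffunE in_cons; case: eqP => [->|]. Qed.

Lemma upd_mix i r q w a : i \notin r -> upd (mix r q w) i a = mix r q (upd w i a).
Proof.
move=> ir; apply/ffunP => j; rewrite !ffunE.
by case: eqP => [->|//]; rewrite (negPf ir).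
Qed.

(** Writing the newly varying argument as a + s p'(s), multilinearity splits off a term with fewer
    varying arguments and [s] times a term of the same kind; hence a second induction, on the Horner
    form. *)
Lemma polyfun_mix (r : seq 'I_m) (q : 'I_m -> k -> A) :
  uniq r -> (forall i, polyfun (q i)) ->
  forall w, polyfun (fun s => op A (mix r (q^~ s) w)).
Proof.
move=> + hq; elim: r => [_ w|i r IH /= /andP[ir ur] w].
  rewrite (_ : (fun s => _) = fun=> op A w); first exact: polyfun_cst.
  by apply/funext => s; congr (op A _); apply/ffunP => j; rewrite ffunE.
under eq_fun do rewrite mix_cons.
elim: (hq i) => [p p0|p p' a _ IHp hp].
  by apply: Polyfun0 => s; rewrite p0 op_upd0.
under eq_fun do rewrite hp op_updD op_updZ upd_mix//.
by apply: polyfunD; [exact: IH|exact: polyfunX].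
Qed.

(** This is the product rule at s = 0; the remainder of an argument contributes from order s^2
    on. *)
Lemma jet_mix (r : seq 'I_m) (q : 'I_m -> k -> A) (a b : 'I_m -> A) :
  uniq r -> (forall i, jet (q i) (a i) (b i)) ->
  forall w, jet (fun s => op A (mix r (q^~ s) w)) (op A (mix r a w))
    (\sum_(i <- r) op A (upd (mix r a w) i (b i))).
Proof.
move=> + hq; have pq i : polyfun (q i) by exact: jet_polyfun (hq i).
elim: r => [_ w|i r IH /= /andP[ir ur] w].
  rewrite (_ : (fun s => _) = fun=> op A w).
    rewrite big_nil (_ : mix _ _ _ = w); first exact: jet_cst.
    by apply/ffunP => j; rewrite ffunE.
  by apply/funext => s; congr (op A _); apply/ffunP => j; rewrite ffunE.
have [g pg hg] := hq i.
have pg' : polyfun (fun s => op A (upd (mix r (q^~ s) w) i (g s))).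
  (* Putting the remainder [g] in place of [q i] gives an instance of [polyfun_mix]. *)
  pose q' j := if j == i then g else q j.
  have pq' j : polyfun (q' j) by rewrite /q'; case: eqP.
  have := @polyfun_mix (i :: r) q' _ pq' w; rewrite /= ir => /(_ ur).
  congr polyfun; apply/funext => s; rewrite mix_cons {2}/q' eqxx.
  congr (op A _); apply/ffunP => j; rewrite !ffunE /q'.
  by case: eqP.
rewrite (_ : (fun s => _) = fun s => op A (mix r (q^~ s) (upd w i (a i)))
  + (s *: op A (mix r (q^~ s) (upd w i (b i)))
     + s *: (s *: op A (upd (mix r (q^~ s) w) i (g s))))); last first.
  apply/funext => s; rewrite mix_cons hg !op_updD !op_updZ !upd_mix//.
  by rewrite scalerA -expr2 addrA.
have j1 := IH ur (upd w i (a i)).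
have j2 := jetX (IH ur (upd w i (b i))).
have [c j3] := polyfun_jet pg'.
have := jetD j1 (jetD j2 (jetX (jetX j3))).
by rewrite !addr0 big_cons mix_cons upd_upd !upd_mix// [X in _ -> jet _ _ X]addrC.
Qed.

End PolynomialOperations.
End Algebra.

(** * The algebra of dual numbers A[e] *)

Section DualNumbers.
Variables (k : fieldType) (m : nat) (u : bool) (A : mary_algebra k m u).

Let fsts (v : {ffun 'I_m -> A * A}) : {ffun 'I_m -> A} := [ffun i => (v i).1].

(** The pair (a, b) stands for a + b e with e^2 = 0. *)
Definition dual_op (v : {ffun 'I_m -> A * A}) : A * A :=
  (op A (fsts v), \sum_i op A (upd (fsts v) i (v i).2)).

Lemma dual_op_multilinear (v : {ffun 'I_m -> A * A}) (i : 'I_m) (c : k)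
    (a b : A * A) :
  dual_op (upd v i (c *: a + b)) = c *: dual_op (upd v i a) + dual_op (upd v i b).
Proof.
rewrite /dual_op /fsts !map_upd; congr (_, _) => /=.
  by rewrite op_multilinear.
rewrite scaler_sumr -big_split /=; apply: eq_bigr => j _.
have [->|ji] := eqVneq j i.
  by rewrite !upd_same !upd_upd op_multilinear.
rewrite eq_sym in ji.
by rewrite !upd_other 1?eq_sym// !(updC _ _ _ ji) op_multilinear.
Qed.

Lemma dual_unity_law (hu : u) (i : 'I_m) (a : A * A) :
  dual_op (upd [ffun=> (unity A hu, 0)] i a) = a.
Proof.
have e : fsts (upd [ffun=> (unity A hu, 0)] i a) = upd [ffun=> unity A hu] i a.1.
  rewrite /fsts map_upd; congr upd.
  by apply/ffunP => j; rewrite !ffunE.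
rewrite /dual_op e unity_law (bigD1 i)//= upd_same upd_upd unity_law big1.
  by rewrite addr0; case: a {e}.
by move=> j ji; rewrite upd_other// ffunE op_upd0.
Qed.

Definition dual_algebra : mary_algebra k m u :=
  MaryAlgebra dual_op_multilinear dual_unity_law.

Hypothesis hk : [pchar k] =i pred0.

(** Calculating modulo s^2 is calculating in A[e], with [s] in the role of e. *)
Lemma jet_eval (rho : nat -> A * A) (t : term k m u) :
  jet (fun s => eval (fun n => (rho n).1 + s *: (rho n).2) t)
    (@eval k m u dual_algebra rho t).1 (@eval k m u dual_algebra rho t).2.
Proof.
elim: t => [n|t1 IH1 t2 IH2|c t IH|ts IH|hu] /=.
- exists (fun=> 0); first exact: Polyfun0.
  by move=> s; rewrite scaler0 addr0.
- exact: jetD.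
- exact: jetZ.
- have := @jet_mix k m u A (enum 'I_m) _ _ _ (enum_uniq _) IH 0.
  have mixE q : mix (enum 'I_m) q (0 : {ffun 'I_m -> A}) = [ffun i => q i].
    by apply/ffunP => i; rewrite !ffunE mem_enum.
  rewrite mixE big_enum /=; congr jet.
  + by apply/funext => s; rewrite mixE.
  + by congr (op A _); apply/ffunP => i; rewrite !ffunE.
  + apply: eq_bigr => i _; congr (op A (upd _ _ _)); last by rewrite ffunE.
    by apply/ffunP => j; rewrite !ffunE.
- exact: jet_cst.
Qed.

Lemma dual_in_variety (V : variety k m u) :
  in_variety V A -> in_variety V dual_algebra.
Proof.
move=> hA t Vt rho.
have [e1 e2] := jet_eq0 hk (jet_eval rho t) (fun s => hA t Vt _).
by move: e1 e2; case: (eval rho t) => a b /= -> ->.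
Qed.

End DualNumbers.

(** * Derivations of the free algebra on one generator *)

Section Derivations.
Variables (k : fieldType) (hk : [pchar k] =i pred0).
Variables (m : nat) (hm : (2 <= m)%N) (u : bool).

Section Theory.
Variables (A : mary_algebra k m u) (d : A -> A) (hd : is_derivation d).

Lemma derD a b : d (a + b) = d a + d b.
Proof. by have := hd.1 1 a b; rewrite !scale1r. Qed.

Lemma der0 : d 0 = 0.
Proof. exact: linear_fun0 hd.1. Qed.

Lemma derZ c a : d (c *: a) = c *: d a.
Proof. by have := hd.1 c a 0; rewrite der0 !addr0. Qed.

Lemma der_sum (I : Type) (r : seq I) (P : pred I) (F : I -> A) :
  d (\sum_(i <- r | P i) F i) = \sum_(i <- r | P i) d (F i).
Proof. by apply: (big_morph d derD der0). Qed.

(** The Leibniz rule on e = <e, ..., e> gives d e = m d e, and m - 1 is invertible. *)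
Lemma der_unity (hu : u) : d (unity A hu) = 0.
Proof.
have i0 : 'I_m by exists 0%N; exact: ltnW.
set e := unity A hu.
have ee : op A [ffun=> e] = e.
  have := unity_law hu i0 e; rewrite -{1}[e](ffunE (fun=> e) i0) upd_id //.
have de : d e *+ m = d e.
  rewrite -[in RHS]ee hd.2 (eq_bigr (fun=> d e)) => [|i _].
    by rewrite sumr_const card_ord.
  by rewrite ffunE unity_law.
apply: (pchar0_mulrn_eq0 hk (n := m.-1)); first by rewrite -ltnS prednK// ltnW.
by apply: (addrI (d e)); rewrite -mulrS prednK ?de ?addr0// ltnW.
Qed.

End Theory.

(** In both composites the terms that differentiate two distinct positions form the same double sum,
    which cancels. *)
Lemma derivation_bracket (A : mary_algebra k m u) (d e : A -> A) :
  is_derivation d -> is_derivation e ->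
  is_derivation (fun a => d (e a) - e (d a)).
Proof.
move=> hd he; split=> [c a b|v].
  rewrite !(derD hd, derD he, derZ hd, derZ he) scalerBr opprD.
  by rewrite addrACA.
have H (d1 e1 : A -> A) : is_derivation d1 -> is_derivation e1 ->
    d1 (e1 (op A v)) = \sum_i op A (upd v i (d1 (e1 (v i))))
      + \sum_i \sum_(j | j != i) op A (upd (upd v i (e1 (v i))) j (d1 (v j))).
  move=> h1 h2; rewrite h2.2 (der_sum h1) -big_split /=; apply: eq_bigr => i _.
  rewrite h1.2 (bigD1 i)//= upd_same upd_upd; congr (_ + _).
  by apply: eq_bigr => j ji; rewrite upd_other.
rewrite (H d e)// (H e d)//.
rewrite [X in _ + X - _](_ : _ =
    \sum_i \sum_(j | j != i) op A (upd (upd v i (d (v i))) j (e (v j)))).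
  rewrite opprD addrACA subrr addr0 -sumrB; apply: eq_bigr => i _.
  by rewrite op_updD -[in RHS]scaleN1r op_updZ scaleN1r.
rewrite (exchange_big_dep predT)//=; apply: eq_bigr => i _.
apply: eq_big => j; first by rewrite eq_sym.
by rewrite eq_sym => ij; rewrite updC.
Qed.

Variables (V : variety k m u) (A : mary_algebra k m u) (x : A).
Hypothesis hA : is_free_on V A x.

Lemma exists_derivation (a : A) : exists2 d : A -> A, is_derivation d & d x = a.
Proof.
have [VA free] := hA.
have [f [[[flin fop funit] fx] _]] := free _ (dual_in_variety hk VA) (x, a).
(* The first component is an endomorphism fixing [x], so freeness makes it the identity; the second
   one is then a derivation. *)
have f1 : (fun p => (f p).1) = id.
  have [g [_ guniq]] := free A VA x.
  rewrite -(guniq (fun p => (f p).1)); first apply: guniq.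
    by split=> //; split=> // v; congr (op A _); apply/ffunP => i; rewrite ffunE.
  split; last by rewrite fx.
  split=> [c p q|v|hu]; first by rewrite flin.
    by rewrite fop /=; congr (op A _); apply/ffunP => i; rewrite !ffunE.
  by rewrite funit.
exists (fun p => (f p).2); last by rewrite fx.
split=> [c p q|v]; first by rewrite flin.
rewrite fop /=; apply: eq_bigr => i _; rewrite ffunE; congr (op A (upd _ _ _)).
by apply/ffunP => j; rewrite !ffunE -[RHS]/(id _) -f1.
Qed.

(** Both p + d(p) e and p + 0 e define homomorphisms to A[e] sending [x] to x + 0 e, and there is
    only one. *)
Lemma derivation_eq0 (d : A -> A) : is_derivation d -> d x = 0 -> forall a, d a = 0.
Proof.
move=> hd dx a; have [VA free] := hA.
have [g [_ guniq]] := free _ (dual_in_variety hk VA) (x, 0).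
have hom (e : A -> A) : is_derivation e -> e x = 0 -> g = fun p => (p, e p).
  move=> he ex; apply: guniq; split; last by rewrite ex.
  split=> [c p q|v|hu]; first by rewrite (derD he) (derZ he).
    rewrite /= he.2 /dual_op; congr (_, _).
      by congr (op A _); apply/ffunP => i; rewrite !ffunE.
    apply: eq_bigr => i _; rewrite ffunE; congr (op A (upd _ _ _)).
    by apply/ffunP => j; rewrite !ffunE.
  by rewrite (der_unity he).
have h0 : is_derivation (fun=> 0 : A).
  split=> [c p q|v]; first by rewrite scaler0 addr0.
  by rewrite big1// => i _; rewrite op_upd0.
by have := hom d hd dx; rewrite (hom _ h0)// => /(congr1 (fun f => (f a).2)).
Qed.

Lemma derP (d : Der A) : is_derivation d.
Proof. by case: d => d /= /asboolP. Qed.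

Lemma partial_val (a : A) : partial x a x = a.
Proof.
rewrite /partial; case: xgetP => [d _ //|none].
have [d hd dx] := exists_derivation a.
have dP : d \in @derivation_pred k m u A by apply/asboolP.
by have := none (MkDer dP).
Qed.

Lemma Der_eq0 (d : Der A) : d x = 0 -> d = 0.
Proof.
by move=> dx; apply/val_inj/funext => a; exact: (derivation_eq0 (derP d) dx).
Qed.

Lemma partial_eq0 (a : A) : partial x a = 0 -> a = 0.
Proof. by move=> e; rewrite -(partial_val a) e. Qed.

End Derivations.

(** * Nilpotency of L in statement (i) *)

Section Multiplication.
Variables (k : fieldType) (m : nat) (u : bool) (A : mary_algebra k m u).
Hypothesis sym : symmetric_op A.
Variables (x : A) (i0 : 'I_m).

Definition mulx (a : A) : A := op A (upd [ffun=> x] i0 a).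

Lemma op_upd_sym (i : 'I_m) (a : A) : op A (upd [ffun=> x] i a) = mulx a.
Proof.
rewrite /mulx -(sym (tperm i i0) (upd [ffun=> x] i0 a)).
congr (op A _); apply/ffunP => j; rewrite !ffunE.
by rewrite -(inj_eq (@perm_inj _ (tperm i i0)) j i) tpermL.
Qed.

Lemma der_power (d : A -> A) :
  is_derivation d -> d (op A [ffun=> x]) = mulx (d x) *+ m.
Proof.
move=> hd; rewrite hd.2 (eq_bigr (fun=> mulx (d x))) => [|i _].
  by rewrite sumr_const card_ord.
by rewrite ffunE op_upd_sym.
Qed.

Lemma mulxZ (c : k) (a : A) : mulx (c *: a) = c *: mulx a.
Proof. exact: op_updZ. Qed.

Lemma mulxD (a b : A) : mulx (a + b) = mulx a + mulx b.
Proof. exact: op_updD. Qed.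

Definition bracket (D T : A -> A) (a : A) : A := D (T a) - T (D a).

Lemma iter_bracket_sum (D : A -> A) (I : Type) (r : seq I) (P : pred I)
    (F : I -> A -> A) (n : nat) : is_derivation D ->
  iter n (bracket D) (fun a => \sum_(i <- r | P i) F i a) =
  fun a => \sum_(i <- r | P i) iter n (bracket D) (F i) a.
Proof.
move=> hD; elim: n => //= n ->; apply/funext => a.
by rewrite /bracket (der_sum hD) -sumrB.
Qed.

(* When [D x = y] and [D y = 0], commuting with [D] adds one position to [B],
   which can happen only m - 1 times. *)
Definition subst_op (y : A) (B : {set 'I_m}) (a : A) : A :=
  op A (upd [ffun j => if j \in B then y else x] i0 a).

Lemma bracket_subst_op (D : A -> A) (B : {set 'I_m}) :
  is_derivation D -> D (D x) = 0 ->
  bracket D (subst_op (D x) B) =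
  fun a => \sum_(i | (i \notin B) && (i != i0)) subst_op (D x) (i |: B) a.
Proof.
move=> hD DD; apply/funext => a.
rewrite /bracket hD.2 (bigD1 i0)//= upd_same upd_upd addrAC subrr add0r.
rewrite (bigID (mem B))/= big1 ?add0r => [|i /andP[ii0 iB]]; last first.
  by rewrite upd_other// ffunE iB DD op_upd0.
apply: eq_big => [i|i /andP[ii0 iB]]; first by rewrite andbC.
rewrite upd_other// ffunE (negPf iB) updC 1?eq_sym//; congr (op A (upd _ _ _)).
by apply/ffunP => j; rewrite !ffunE in_setU1; case: eqP.
Qed.

(** Each bracket enlarges [B] by one position other than [i0], so [B] never exceeds m - 1
    elements. *)
Lemma iter_bracket_subst_op (D : A -> A) (n : nat) (B : {set 'I_m}) :
  is_derivation D -> D (D x) = 0 -> i0 \notin B -> (m <= n + #|B|)%N ->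
  iter n (bracket D) (subst_op (D x) B) = fun=> 0.
Proof.
move=> hD DD; elim: n B => [|n IHn] B i0B mB.
  have : (#|i0 |: B| <= m)%N by rewrite -[X in (_ <= X)%N]card_ord max_card.
  by rewrite cardsU1 i0B add1n ltnNge mB.
rewrite iterSr bracket_subst_op// iter_bracket_sum//; apply/funext => a.
rewrite big1// => i /andP[iB ii0]; rewrite IHn//.
  by rewrite in_setU1 negb_or eq_sym ii0.
by rewrite cardsU1 iB add1n addnS -addSn.
Qed.

(** Since ad(D) is a derivation of operators, [D, L] = c L^2 implies [D, L^j] = j c L^(j+1); the
    factors accumulate to n! c^n. *)
Lemma iter_bracket_mulx (D : A -> A) (c : k) (n : nat) :
  is_derivation D -> (forall a, bracket D mulx a = c *: mulx (mulx a)) ->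
  iter n (bracket D) mulx = fun a => (n`!%:R * c ^+ n) *: iter n.+1 mulx a.
Proof.
move=> hD hL.
have hLn j a : bracket D (iter j mulx) a = (j%:R * c) *: iter j.+1 mulx a.
  rewrite /bracket; elim: j a => [|j IHj] a; first by rewrite subrr mul0r scale0r.
  have := hL (iter j mulx a); rewrite /bracket /= => /eqP; rewrite subr_eq => /eqP ->.
  have := IHj a => /eqP; rewrite subr_eq => /eqP ->.
  by rewrite mulxD addrA addrK mulxZ -scalerDl -[X in X + _]mul1r -mulrDl -mulrS.
elim: n => [|n IHn].
  by apply/funext => a; rewrite fact0 expr0 mulr1 scale1r.
rewrite iterS IHn; apply/funext => a.
rewrite /bracket (derZ hD) -scalerBr; have := hLn n.+1 a; rewrite /bracket => ->.
by rewrite scalerA factS natrM exprSr mulrACA (mulrC n`!%:R).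
Qed.

Hypothesis hk : [pchar k] =i pred0.

Lemma mulx_nilpotent (D : A -> A) :
  is_derivation D -> D x = op A [ffun=> x] -> D (D x) = 0 ->
  (forall a, exists2 d : A -> A, is_derivation d & d x = a) ->
  forall a, iter m.+1 mulx a = 0.
Proof.
move=> hD Dx DD derx.
have m0 : (0 < m)%N by exact: leq_ltn_trans (ltn_ord i0).
have hL a : bracket D mulx a = - m%:R *: mulx (mulx a).
  have [d hd dx] := derx a.
  (* The derivation [D, d] is applied to D x = <x, ..., x>: directly, this gives D (d (D x)) = m D
     (L a), and by the Leibniz rule m L (D a - m L a). *)
  have := der_power (derivation_bracket hD hd).
  rewrite -Dx DD (der0 hd) subr0 Dx (der_power hd) dx => e.
  have {e} : (D (mulx a) - mulx (D a) + m%:R *: mulx (mulx a)) *+ m = 0.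
    have mulxN b : mulx (- b) = - mulx b by rewrite -scaleN1r mulxZ scaleN1r.
    rewrite -!scaler_nat (derZ hD) mulxD mulxN mulxZ in e.
    by rewrite -scaler_nat -addrA scalerDr e -scalerDr addrACA subrr addNr addr0 scaler0.
  move=> /(pchar0_mulrn_eq0 hk m0)/eqP; rewrite addr_eq0 => /eqP.
  by rewrite /bracket scaleNr.
move=> a.
have := @iter_bracket_subst_op D m finset.set0 hD DD.
rewrite finset.in_set0 cards0 addn0 => /(_ isT (leqnn _)).
rewrite (_ : subst_op _ _ = mulx); last first.
  apply/funext => b; congr (op A (upd _ _ _)).
  by apply/ffunP => j; rewrite !ffunE finset.in_set0.
rewrite (iter_bracket_mulx _ hD hL) => /(congr1 (@^~ a)) /eqP.
(* The coefficient m! (- m)^m is nonzero. *)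
rewrite scaler_eq0 mulf_eq0 expf_eq0 oppr_eq0 !((pcharf0P k).1 hk).
by rewrite gtn_eqF ?fact_gt0// (gtn_eqF m0) andbF => /eqP.
Qed.

End Multiplication.

(** * Integral noncommutative polynomials acting as operators *)

(* Words in the two letters [false], standing for L, and [true], for M. *)
Definition word := seq bool.
Definition ncpoly := seq (int * word).

Definition nc_scale (c : int) (p : ncpoly) : ncpoly :=
  [seq (c * t.1, t.2) | t <- p].

Definition nc_mul (w1 : word) (p : ncpoly) (w2 : word) : ncpoly :=
  [seq (t.1, w1 ++ t.2 ++ w2) | t <- p].

(** An entry (c, w1, i, w2) encodes c w1 r_i w2 with r_i the relation of index i, so the result lies
    in the two-sided ideal of the relations. *)
Definition nc_comb (rels : seq ncpoly) (cs : seq (int * word * nat * word)) :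
    ncpoly :=
  flatten [seq nc_scale t.1.1.1 (nc_mul t.1.1.2 (nth [::] rels t.1.2) t.2)
          | t <- cs].

Fixpoint nc_insert (c : int) (w : word) (p : ncpoly) : ncpoly :=
  if p is (d, w') :: p' then
    if w == w' then (c + d, w') :: p' else (d, w') :: nc_insert c w p'
  else [:: (c, w)].

(** Equal words may occur repeatedly in an [ncpoly]; they are collected only here. *)
Definition nc_eq0 (p : ncpoly) : bool :=
  all (fun t => t.1 == 0) (foldr (fun t => nc_insert t.1 t.2) [::] p).

Section Derivation.
Variable img : bool -> ncpoly.

Fixpoint word_der (w : word) : ncpoly :=
  if w is b :: w' then nc_mul [::] (img b) w' ++ nc_mul [:: b] (word_der w') [::]
  else [::].

Definition nc_der (p : ncpoly) : ncpoly :=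
  flatten [seq nc_scale t.1 (word_der t.2) | t <- p].

End Derivation.

Section Evaluation.
Variables (k : fieldType) (V : lmodType k) (F : bool -> V -> V).

Definition word_eval (w : word) (a : V) : V := foldr F a w.

Definition nc_eval (p : ncpoly) (a : V) : V :=
  \sum_(t <- p) t.1%:~R *: word_eval t.2 a.

Definition vanishing (p : ncpoly) : Prop := forall a, nc_eval p a = 0.

Lemma word_eval_cat w1 w2 a : word_eval (w1 ++ w2) a = word_eval w1 (word_eval w2 a).
Proof. by rewrite /word_eval foldr_cat. Qed.

Lemma nc_eval_nil a : nc_eval [::] a = 0.
Proof. exact: big_nil. Qed.

Lemma nc_eval_cons t p a :
  nc_eval (t :: p) a = t.1%:~R *: word_eval t.2 a + nc_eval p a.
Proof. exact: big_cons. Qed.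

Lemma nc_eval_cat p q a : nc_eval (p ++ q) a = nc_eval p a + nc_eval q a.
Proof. exact: big_cat. Qed.

Lemma nc_eval_flatten ps a : nc_eval (flatten ps) a = \sum_(p <- ps) nc_eval p a.
Proof.
elim: ps => [|p ps IH] /=; first by rewrite nc_eval_nil big_nil.
by rewrite nc_eval_cat big_cons IH.
Qed.

Lemma nc_eval_scale c p a : nc_eval (nc_scale c p) a = c%:~R *: nc_eval p a.
Proof.
rewrite /nc_eval big_map scaler_sumr; apply: eq_bigr => t _ /=.
by rewrite scalerA intrM.
Qed.

Lemma nc_eq0P p : nc_eq0 p -> vanishing p.
Proof.
have insE c w q a :
    nc_eval (nc_insert c w q) a = c%:~R *: word_eval w a + nc_eval q a.
  elim: q => [|[d w'] q IH] /=; first by rewrite nc_eval_cons.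
  case: eqP => [->|_]; rewrite !nc_eval_cons /=; last by rewrite IH addrCA.
  by rewrite intrD scalerDl addrA.
move=> p0 a.
have -> : nc_eval p a = nc_eval (foldr (fun t => nc_insert t.1 t.2) [::] p) a.
  by elim: p {p0} => //= t p IH; rewrite nc_eval_cons insE IH.
rewrite /nc_eval big_seq big1 // => t tp.
by have /eqP-> := allP p0 t tp; rewrite scale0r.
Qed.

Hypothesis Flin : forall b, linear (F b).

Lemma word_evalP w (c : k) a b :
  word_eval w (c *: a + b) = c *: word_eval w a + word_eval w b.
Proof. by elim: w => //= l w ->; rewrite Flin. Qed.

Lemma word_eval0 w : word_eval w 0 = 0.
Proof. by apply: linear_fun0 => c a b; exact: word_evalP. Qed.

Lemma nc_eval_mul w1 p w2 a :
  nc_eval (nc_mul w1 p w2) a = word_eval w1 (nc_eval p (word_eval w2 a)).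
Proof.
elim: p => [|t p IH] /=; first by rewrite !nc_eval_nil word_eval0.
by rewrite !nc_eval_cons /= IH !word_eval_cat word_evalP.
Qed.

Hypothesis hk : [pchar k] =i pred0.

(** A positive multiple of [p] lies in the ideal of the relations. The multiple clears denominators
    and can be divided out in characteristic 0. *)
Lemma certificate (rels : seq ncpoly) (n : nat) (p : ncpoly)
    (cs : seq (int * word * nat * word)) :
  (forall i, vanishing (nth [::] rels i)) ->
  nc_eq0 (nc_scale n.+1 p ++ nc_scale (-1) (nc_comb rels cs)) -> vanishing p.
Proof.
move=> hrels /nc_eq0P h a; have := h a.
rewrite nc_eval_cat !nc_eval_scale nc_eval_flatten big_map big1 => [|t _].
  by rewrite scaler0 addr0 -pmulrn scaler_nat => /(pchar0_mulrn_eq0 hk); apply.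
by rewrite nc_eval_scale nc_eval_mul hrels word_eval0 scaler0.
Qed.

Section Der.
Variables (D : V -> V) (img : bool -> ncpoly).
Hypothesis Dlin : linear D.
Hypothesis DF : forall b a, D (F b a) = nc_eval (img b) a + F b (D a).

Lemma der_word_eval w a :
  D (word_eval w a) = nc_eval (word_der img w) a + word_eval w (D a).
Proof.
elim: w => [|b w IH] /=; first by rewrite nc_eval_nil add0r.
rewrite DF IH nc_eval_cat !nc_eval_mul /= -addrA.
have := Flin b 1 (nc_eval (word_der img w) a) (word_eval w (D a)).
by rewrite !scale1r => ->.
Qed.

Lemma der_nc_eval p a : D (nc_eval p a) = nc_eval (nc_der img p) a + nc_eval p (D a).
Proof.
elim: p => [|t p IH].
  by rewrite !nc_eval_nil addr0 linear_fun0.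
rewrite (_ : nc_der img (t :: p) =
  nc_scale t.1 (word_der img t.2) ++ nc_der img p)//.
rewrite !nc_eval_cons Dlin IH der_word_eval scalerDr nc_eval_cat.
by rewrite nc_eval_scale addrACA.
Qed.

(** [nc_der img p] represents the commutator of D with the operator of [p]. *)
Lemma vanishing_der p : vanishing p -> vanishing (nc_der img p).
Proof.
by move=> p0 a; have := der_nc_eval p a; rewrite !p0 addr0 (linear_fun0 Dlin).
Qed.

End Der.
End Evaluation.

(** * Relations between L and M for statement (ii) *)

Local Notation L := false.
Local Notation M := true.

(* The multiplications by [t], and below by [z], in terms of L and M. *)
Definition nc_t : ncpoly := [:: ((-2)%Z, [:: L; L; L]); ((-1)%Z, [:: L; M])].

(** The commutator of a derivation with a multiplication is multiplication by the derivative: D x =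
    y, D y = 2 t, and E x = t, E y = 0. *)
Definition img_D (b : bool) : ncpoly :=
  if b then nc_scale 2%Z nc_t else [:: (1%Z, [:: M])].
Definition img_E (b : bool) : ncpoly := if b then [::] else nc_t.

Definition nc_z : ncpoly := nc_der img_D nc_t.

(* [rel5] compares the expressions for 4 y t coming from D z and from E t, and
   [rel6] expresses E z = 0; the others are named after their degrees, [x] having
   degree 1. *)
Definition rel5 : ncpoly :=
  nc_der img_D nc_z ++ nc_scale (-4)%Z (nc_der img_E nc_t).
Definition rel6 : ncpoly := nc_der img_E nc_z.

Definition rels : seq ncpoly :=
  [:: rel5; rel6; nc_der img_D rel5; nc_der img_D (nc_der img_D rel5);
      nc_der img_E rel5; nc_der img_D rel6].

(** 32 L^7 + p(l, r) M with p = 3 l^5 + 3 l^4 r + 2 l^2 r^3 - 4 l r^4 - 4 r^5. *)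
Definition rel7 : ncpoly :=
  [:: (32%Z, nseq 7 L);
      ((-4)%Z, [:: M; L; L; L; L; L]); ((-4)%Z, [:: L; M; L; L; L; L]);
      (2%Z, [:: L; L; M; L; L; L]); (3%Z, [:: L; L; L; L; M; L]);
      (3%Z, [:: L; L; L; L; L; M])].

(** 64 L^8 + q(l, r) M with q = 3 l^5 r + 3 l^4 r^2 - 2 l^3 r^3 - 12 l r^5 - 8 r^6. *)
Definition rel8 : ncpoly :=
  [:: (64%Z, nseq 8 L);
      ((-8)%Z, [:: M; L; L; L; L; L; L]); ((-12)%Z, [:: L; M; L; L; L; L; L]);
      ((-2)%Z, [:: L; L; L; M; L; L; L]); (3%Z, [:: L; L; L; L; M; L; L]);
      (3%Z, [:: L; L; L; L; L; M; L])].

(* The coefficients of this certificate and of the next one were found by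
   solving linear systems over the rationals. *)
Lemma rel7_certificate :
  nc_eq0 (nc_scale 128%N rel7 ++ nc_scale (-1) (nc_comb rels
    [:: ((8)%Z, [::], 5, [::]); ((-32)%Z, [:: M], 0, [::]);
        ((-5)%Z, [::], 3, [::]); ((-22)%Z, [::], 0, [:: M]);
        ((-28)%Z, [::], 0, [:: L; L]); ((-176)%Z, [::], 1, [:: L]);
        ((-32)%Z, [:: L], 1, [::]); (32%Z, [:: L], 0, [:: L]);
        (16%Z, [:: L; L], 0, [::])]%N)).
Proof. by vm_compute. Qed.

Lemma rel8_certificate :
  nc_eq0 (nc_scale 64%N rel8 ++ nc_scale (-1) (nc_comb rels
    [:: (44%Z, [::], 0, [:: L; L; L]); (14%Z, [::], 0, [:: M; L]);
        (12%Z, [::], 4, [:: L]); ((-1)%Z, [::], 3, [:: L]);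
        (8%Z, [::], 5, [:: L]); (10%Z, [:: L], 0, [:: M]);
        (6%Z, [:: L], 4, [::]); ((-4)%Z, [:: L], 0, [:: L; L]);
        (4%Z, [:: L; M], 0, [::]); (4%Z, [:: L], 5, [::])]%N)).
Proof. by vm_compute. Qed.

(** The first five entries apply - q(l, r) to [rel7], the last five apply p(l, r) to [rel8]. The
    terms with M cancel, leaving 32 * 16 + 64 * 0 = 512. *)
Lemma rel13_certificate :
  nc_eq0 (nc_scale 512%N [:: (1%Z, nseq 13 L)] ++
    nc_scale (-1) (nc_comb [:: rel7; rel8]
    [:: (8%Z, [::], 0, nseq 6 L); (12%Z, nseq 1 L, 0, nseq 5 L);
        (2%Z, nseq 3 L, 0, nseq 3 L); ((-3)%Z, nseq 4 L, 0, nseq 2 L);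
        ((-3)%Z, nseq 5 L, 0, nseq 1 L);
        ((-4)%Z, [::], 1, nseq 5 L); ((-4)%Z, nseq 1 L, 1, nseq 4 L);
        (2%Z, nseq 2 L, 1, nseq 3 L); (3%Z, nseq 4 L, 1, nseq 1 L);
        (3%Z, nseq 5 L, 1, [::])]%N)).
Proof. by vm_compute. Qed.

(** * Commutative algebras with ((x x) x) x = 0 *)

Section QuarticNil.
Variables (k : fieldType) (hk : [pchar k] =i pred0) (V : lmodType k).
Variable mul : V -> V -> V.
Local Infix "**" := mul (at level 40, left associativity).
Hypothesis mulC : commutative mul.
Hypothesis mull : forall a, linear (mul a).

Definition leibniz (d : V -> V) : Prop :=
  linear d /\ forall a b, d (a ** b) = d a ** b + a ** d b.

Variable x : V.
Hypothesis derx : forall a, exists2 d, leibniz d & d x = a.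
Hypothesis x4 : ((x ** x) ** x) ** x = 0.

Let y := x ** x.
Let t := y ** x.
Let z := y ** y.

Let F (b : bool) : V -> V := if b then mul y else mul x.

Lemma Flin b : linear (F b).
Proof. by rewrite /F; case: b; apply: mull. Qed.

Lemma mulr0 a : a ** 0 = 0.
Proof. exact: linear_fun0 (mull a). Qed.

Lemma leibniz_square d a : leibniz d -> d (a ** a) = a ** d a *+ 2.
Proof. by move=> [_ dM]; rewrite dM mulC mulr2n. Qed.

Lemma mul_mulrn a b n : a ** (b *+ n) = a ** b *+ n.
Proof.
rewrite -!scaler_nat; have := mull a n%:R b 0.
by rewrite mulr0 !addr0.
Qed.

(** A derivation with d x = a turns the quartic identity into t a + 2 x (x (x a)) + x (y a) = 0. *)
Lemma mul_tE a : t ** a = nc_eval F nc_t a.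
Proof.
have [d dL dx] := derx a; have [dlin dM] := dL.
have := congr1 d x4; rewrite (linear_fun0 dlin) !dM dx.
rewrite !nc_eval_cons nc_eval_nil addr0 /= -/y -/t.
rewrite (mulC a) -mulr2n (mulC (_ *+ 2)) mul_mulrn.
have := mull x 1 (x ** (x ** a) *+ 2) (y ** a); rewrite !scale1r => e.
rewrite (mulC _ x) e mul_mulrn => /eqP; rewrite addr_eq0 => /eqP h.
by rewrite -[t ** a]opprK -h opprD -scaler_nat -scaleNr -[- (x ** _)]scaleN1r.
Qed.

Lemma mulx13_eq0 a : iter 13 (mul x) a = 0.
Proof.
have [D DL Dx] := derx y; have [E EL Ex] := derx t.
have [[Dlin DM] [Elin EM]] := (DL, EL).
have Dy : D y = t *+ 2 by rewrite /y leibniz_square// Dx mulC.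
have xt : x ** t = 0 by rewrite mulC.
have Dt : D t = z.
  by rewrite /t DM Dy Dx mulC mul_mulrn xt mul0rn add0r.
have Dz : D z = y ** t *+ 4.
  by rewrite /z leibniz_square// Dy mul_mulrn -mulrnA.
have Ey : E y = 0 by rewrite /y leibniz_square// Ex xt mul0rn.
have Et : E t = y ** t by rewrite /t EM Ey Ex mulC mulr0 add0r.
have Ez : E z = 0 by rewrite /z leibniz_square// Ey mulr0 mul0rn.
have DF b a' : D (F b a') = nc_eval F (img_D b) a' + F b (D a').
  case: b.
    change (D (y ** a') = nc_eval F (nc_scale 2%Z nc_t) a' + y ** D a').
    rewrite DM Dy nc_eval_scale -mul_tE (mulC (_ *+ 2)) mul_mulrn (mulC a').
    by rewrite -scaler_nat.
  by rewrite /= DM Dx nc_eval_cons nc_eval_nil addr0 /= scale1r.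
have EF b a' : E (F b a') = nc_eval F (img_E b) a' + F b (E a').
  case: b; rewrite /= EM.
    by rewrite Ey mulC mulr0 nc_eval_nil.
  by rewrite Ex mul_tE.
have derE d img p a' : linear d ->
    (forall b a, d (F b a) = nc_eval F (img b) a + F b (d a)) ->
    nc_eval F (nc_der img p) a' = d (nc_eval F p a') - nc_eval F p (d a').
  by move=> dlin dF; rewrite (der_nc_eval Flin dlin dF) addrK.
have zE a' : z ** a' = nc_eval F nc_z a'.
  by rewrite /nc_z (derE D)// -!mul_tE DM Dt addrK.
have v5 : vanishing F rel5.
  move=> a'; rewrite nc_eval_cat nc_eval_scale (derE D)// -!zE (derE E)// -!mul_tE.
  rewrite DM EM Dz Et !addrK mulC mul_mulrn mulC -scaler_nat -scalerDl.
  by rewrite [(-4)%:~R]rmorphN subrr scale0r.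
have v6 : vanishing F rel6.
  by move=> a'; rewrite (derE E)// -!zE EM Ez addrK mulC mulr0.
have v0 : vanishing F [::] by move=> a'; rewrite nc_eval_nil.
have vD p : vanishing F p -> vanishing F (nc_der img_D p).
  exact: (vanishing_der Flin Dlin DF).
have vE p : vanishing F p -> vanishing F (nc_der img_E p).
  exact: (vanishing_der Flin Elin EF).
have vrels i : vanishing F (nth [::] rels i).
  case: i => [|[|[|[|[|[|i]]]]]]; last by rewrite nth_default.
  - exact: v5.
  - exact: v6.
  - exact: vD v5.
  - exact: vD (vD _ v5).
  - exact: vE v5.
  - exact: vD v6.
have v7 := certificate Flin hk vrels rel7_certificate.
have v8 := certificate Flin hk vrels rel8_certificate.
have v78 i : vanishing F (nth [::] [:: rel7; rel8] i).
  by case: i => [|[|i]]; last by rewrite nth_default.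
have := certificate Flin hk v78 rel13_certificate a.
by rewrite nc_eval_cons nc_eval_nil addr0 scale1r.
Qed.

End QuarticNil.

(** * The case m = 2 as a binary product, and the theorem *)

Section Binary.
Variables (k : fieldType) (u : bool) (A : mary_algebra k 2 u).

Definition pair_ffun (T : Type) (a b : T) : {ffun 'I_2 -> T} :=
  [ffun i => if i == ord0 then a else b].

Definition mul2 (a b : A) : A := op A (pair_ffun a b).

Lemma upd_pair0 (T : Type) (a b c : T) : upd (pair_ffun a b) ord0 c = pair_ffun c b.
Proof. by apply/ffunP => i; rewrite !ffunE; case: eqP. Qed.

Lemma upd_pair1 (T : Type) (a b c : T) :
  upd (pair_ffun a b) (lift ord0 ord0) c = pair_ffun a c.
Proof.
apply/ffunP => i; rewrite !ffunE.
by case: (unliftP ord0 i) => [j ->|->] //; rewrite (ord1 j) eqxx.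
Qed.

Lemma mul2_linear (a : A) : linear (mul2 a).
Proof.
move=> c b b'.
by rewrite /mul2 -(upd_pair1 a 0 (c *: b + b')) op_multilinear !upd_pair1.
Qed.

Lemma mul2C : symmetric_op A -> commutative mul2.
Proof.
move=> sym a b; rewrite /mul2 -(sym (tperm ord0 (lift ord0 ord0))).
congr (op A _); apply/ffunP => i; rewrite !ffunE.
by case: (unliftP ord0 i) => [j ->|->]; rewrite ?(ord1 j) ?tpermR ?tpermL.
Qed.

Lemma derivation_leibniz (d : A -> A) : is_derivation d -> leibniz mul2 d.
Proof.
move=> [dlin dM]; split=> // a b.
rewrite /mul2 dM big_ord_recl big_ord1 upd_pair0 upd_pair1.
by rewrite !ffunE.
Qed.

End Binary.

Theorem lemma6 (k : fieldType) (hk : [pchar k] =i pred0)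
    (m : nat) (hm : (2 <= m)%N)
    (u : bool) (hu : u -> m = 2%N)
    (V : variety k m u) (hV : nontrivial_variety V)
    (hsym : symmetric_variety V)
    (A : mary_algebra k m u) (x : A) (hA : is_free_on V A x) :
  let D : Der A := partial x (op A [ffun=> x]) in
  (lmul x D D = 0 -> nilpotent_map (right_mul x D)) /\
  (m = 2%N -> lmul x (lmul x D D) D = 0 -> nilpotent_map (right_mul x D)).
Proof.
move=> D; have sym := hsym A hA.1.
have pv := partial_val hk hA.
have Dx : D x = op A [ffun=> x] by exact: pv.
have i0 : 'I_m by exists 0%N; exact: ltnW.
(* At [x], the derivation R_D E takes the value E <x, ..., x> = m L (E x). *)
have iterE n (E : Der A) :
    iter n (right_mul x D) E x = (m ^ n)%:R *: iter n (mulx x i0) (E x).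
  elim: n => [|n IHn]; first by rewrite scale1r.
  rewrite !iterS {1}/right_mul /lmul pv Dx (der_power sym x i0 (derP _)) IHn.
  by rewrite mulxZ -scaler_nat scalerA expnS natrM.
have nil n : (forall a, iter n (mulx x i0) a = 0) -> nilpotent_map (right_mul x D).
  by move=> h; exists n => E; apply: (Der_eq0 hk hm hA); rewrite iterE h scaler0.
split=> [D2|m2 D3].
  have DD := partial_eq0 hk hA D2.
  exact: nil (mulx_nilpotent sym i0 hk (derP D) Dx DD (exists_derivation hk hA)).
subst m; apply: (nil 13%N) => a.
have mulxE : mulx x i0 = mul2 x.
  apply/funext => b.
  rewrite -(op_upd_sym sym x i0 (lift ord0 ord0)) /mul2 -(upd_pair1 x x b).
  by congr (op A (upd _ _ _)); apply/ffunP => j; rewrite !ffunE; case: ifP.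
have sqE : op A [ffun=> x] = mul2 x x.
  by congr (op A _); apply/ffunP => j; rewrite !ffunE; case: ifP.
rewrite mulxE; apply: mulx13_eq0 => //.
- exact: mul2C.
- exact: mul2_linear.
- move=> b; have [d hd dx] := exists_derivation hk hA b.
  by exists d => //; apply: derivation_leibniz.
have mulC := mul2C sym.
(* At [x] the hypothesis reads E (x x) = 0 with E = D^2. As E x = 2 (x x) x, this is 4 ((x x) x) x =
   0. *)
have := partial_eq0 hk hA D3.
rewrite Dx {1}sqE; set E := lmul x D D.
have [_ ->] := derivation_leibniz (derP E).
have -> : E x = mul2 (mul2 x x) x *+ 2.
  rewrite /E /lmul pv Dx sqE; have [_ ->] := derivation_leibniz (derP D).
  by rewrite Dx sqE (mulC x) -mulr2n.
rewrite (mulC x) -mulr2n.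
have Mn b c n : mul2 b (c *+ n) = mul2 b c *+ n.
  by apply: mul_mulrn; apply: mul2_linear.
rewrite mulC Mn -mulrnA => /(pchar0_mulrn_eq0 hk) h.
by rewrite mulC; apply: h.
Qed.
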